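(* Let $p\ge1$ and $n\ge1$, and let $\mathcal{I}^p_n$ be the ideal of $\mathbb{Q}[x^{(1)}_1,\dots,x^{(p)}_1,\dots,x^{(1)}_n,\dots,x^{(p)}_n]$ generated by all $G^p$-quasisymmetric polynomials with zero constant term. Then $$\dim_{\mathbb{Q}}\mathbb{Q}[x^{(1)}_1,\dots,x^{(p)}_n]/\mathcal{I}^p_n=\frac{1}{pn+1}\binom{(p+1)n}{n}.$$
   Context: A $p$-vector of size $k$ is a vector $c=(c_1,\dots,c_{pk})$ of nonnegative integers, the entries being grouped into $k$ consecutive blocks of $p$ entries, the $s$-th entry of each block referring to the alphabet $x^{(s)}$. A $p$-composition is a $p$-vector with no $p$ consecutive entries all equal to $0$ (the empty one allowed). Write $|c|=\sum c_j$. For a $p$-composition $c$ of size $k$, the fundamental $G^p$-quasisymmetric polynomial is $F_c=\sum\prod_{r=1}^{|c|}z_r$, where positions $1,\dots,|c|$ are split into consecutive runs of lengths $c_1,\dots,c_{pk}$, runs $p(t-1)+1,\dots,pt$ forming block $t$; the sum is over $1\le m_1\le\dots\le m_{|c|}\le n$ with $m_r<m_{r+1}$ whenever $r$ is the last position of a block, and $z_r=x^{(s)}_{m_r}$ if position $r$ lies in a run of index congruent to $s$ modulo $p$ ($s\in\{1,\dots,p\}$). (E.g. for $p=3$, writing $x,y,z$ for $x^{(1)},x^{(2)},x^{(3)}$: $F_{(0,1,0,2,0,1)}=\sum_{i<j\le k\le l}y_ix_jx_kz_l$.) $F_c=0$ if $k>n$, $F_\emptyset=1$. $G^p$-quasisymmetric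 polynomials are the elements of the $\mathbb{Q}$-span of the $F_c$. *)

(* Defs.v *)
From HB Require Import structures.
From mathcomp Require Import all_boot all_order all_algebra.
From mathcomp Require Import ring_quotient generic_quotient boolp mpoly.

Set Implicit Arguments.
Unset Strict Implicit.
Unset Printing Implicit Defensive.

Import GRing.Theory.
Local Open Scope ring_scope.

Section Span.

Variables (K : nzRingType) (V : lmodType K).

Definition lin_span (S : V -> Prop) (v : V) : Prop :=
  exists2 s : seq (K * V),
    forall x, x \in s -> S x.2 & v = \sum_(x <- s) x.1 *: x.2.

End Span.

Section IdealQuotient.

Variables (K : comNzRingType) (A : comAlgType K) (S : A -> Prop).

Definition in_ideal (f : A) : Prop :=
  exists2 s : seq (A * A),
    forall x, x \in s -> S x.2 & f = \sum_(x <- s) x.1 * x.2.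

Definition ideal_gen : {pred A} := fun f => `[< in_ideal f >].

Lemma ideal_genMl g f : f \in ideal_gen -> g * f \in ideal_gen.
Proof.
move=> /asboolP [s Ss ->]; apply/asboolP.
exists [seq (g * x.1, x.2) | x <- s]; first by move=> _ /mapP [x /Ss Sx ->].
by rewrite big_map mulr_sumr; apply: eq_bigr => x _; rewrite mulrA.
Qed.

Fact ideal_gen_zmod_closed : zmod_closed ideal_gen.
Proof.
split=> [|f g fI].
  by apply/asboolP; exists [::]; rewrite ?big_nil.
rewrite -mulN1r => /(ideal_genMl (-1)) /asboolP [t St ->].
case/asboolP: fI => s Ss ->; apply/asboolP; exists (s ++ t).
  by move=> x; rewrite mem_cat => /orP [/Ss | /St].
by rewrite big_cat.
Qed.

HB.instance Definition _ := GRing.isZmodClosed.Build A ideal_gen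
  ideal_gen_zmod_closed.

(* The library's ring structure on {ideal_quot I} is only available for proper
   ideals; the scalar action needs no such assumption. *)
Definition ideal_quotient := {ideal_quot ideal_gen}.

HB.instance Definition _ := ZmodQuotient.on ideal_quotient.

Local Open Scope quotient_scope.

Definition quotient_scale (a : K) (u : ideal_quotient) : ideal_quotient :=
  \pi_ideal_quotient (a *: repr u).

Lemma quotient_scaleE a f :
  quotient_scale a (\pi_ideal_quotient f) = \pi_ideal_quotient (a *: f).
Proof.
apply/eqP; rewrite /quotient_scale -Quotient.idealrBE -scalerBr -mulr_algl.
by apply: ideal_genMl; rewrite Quotient.idealrBE reprK.
Qed.

Fact quotient_scaleA a b u :
  quotient_scale a (quotient_scale b u) = quotient_scale (a * b) u.
Proof.
by elim/quotW: u => f; rewrite (quotient_scaleE b) !quotient_scaleE scalerA.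
Qed.

Fact quotient_scale1 : left_id 1 quotient_scale.
Proof. by move=> u; rewrite -[u]reprK quotient_scaleE scale1r. Qed.

Fact quotient_scaleDr : right_distributive quotient_scale +%R.
Proof.
move=> a u v; rewrite -[u]reprK -[v]reprK !quotient_scaleE.
rewrite -(raddfD \pi_ideal_quotient) quotient_scaleE scalerDr.
exact: raddfD.
Qed.

Fact quotient_scaleDl u : {morph quotient_scale^~ u : a b / a + b}.
Proof.
move=> a b; rewrite -[u]reprK !quotient_scaleE scalerDl; exact: raddfD.
Qed.

HB.instance Definition _ := GRing.Zmodule_isLmodule.Build K ideal_quotient
  quotient_scaleA quotient_scale1 quotient_scaleDr quotient_scaleDl.

End IdealQuotient.

Definition has_dim (K : fieldType) (V : lmodType K) (d : nat) : Prop :=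
  inhabited (Vector.axiom d V).

Section Quasisymmetric.

Variables (p n : nat) (p_gt0 : (0 < p)%N).

Notation polyring := {mpoly rat[n * p]}.

(* The variable x^(s)_i, with alphabets and indices both counted from 0. *)
Definition xvar (s : 'I_p) (i : 'I_n) : polyring := 'X_(mxvec_index i s).

(* The size of a p-vector is recovered from its length p * k. The forbidden
   p consecutive zeros may straddle two blocks. *)
Definition pcomposition (c : seq nat) : bool :=
  (p %| size c)%N && ~~ infix (nseq p 0%N) c.

(* Positions and runs are counted from 0: [reshape_index c r] is the run
   containing position r (empty runs are skipped). *)
Definition block (c : seq nat) (r : nat) : nat := (reshape_index c r %/ p)%N.

Definition alphabet (c : seq nat) (r : nat) : 'I_p :=
  Ordinal (ltn_pmod (reshape_index c r) p_gt0).

Definition admissible (c : seq nat) (m : {ffun 'I_(sumn c) -> 'I_n}) : bool :=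
  [forall r : 'I_(sumn c), forall r' : 'I_(sumn c), (r' == r.+1 :> nat) ==>
     (if block c r == block c r' then (m r <= m r')%N else (m r < m r')%N)].

(* No clause is needed for c of size k > n: every block of a p-composition is
   nonempty, so an admissible m takes at least k values and the sum is empty. *)
Definition fundamental (c : seq nat) : polyring :=
  \sum_(m : {ffun 'I_(sumn c) -> 'I_n} | admissible m)
     \prod_(r < sumn c) xvar (alphabet c r) (m r).

Definition Gquasisymmetric : polyring -> Prop :=
  lin_span (fun f => exists2 c, pcomposition c & f = fundamental c).

Definition Gquasisymmetric0 (f : polyring) : Prop :=
  Gquasisymmetric f /\ f@_0%MM = 0.

Definition Gquotient : lmodType rat := ideal_quotient Gquasisymmetric0.

End Quasisymmetric.

(* Main.v *)
(** List the variables block by block, z_{ip+s} = x^(s)_i. A p-composition of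
    degree d is then an increasing sequence t of run indices with t_0 < p and
    all gaps at most p, and F_c is the sum of the products of the
    z_{t_r + p b_r} over 0 <= b_0 <= ... <= b_{d-1}. Call a monomial good when,
    for every r, at most r of its factors have index below p(r+1). The good
    monomials form a basis of the quotient.

    Spanning. A non-good monomial is the lexicographically leading monomial of
    an element of the ideal, built from the sums above (allowing any t_0) by
    means of F_{t-p} = z_{t_0-p} F_{t'-p} + F_t, where t' is the tail of t.

    Independence, by induction on n. Let R_i set z_i, ..., z_{i+p-1} to 0 and
    renumber the remaining variables. R_i maps each F_c to F_c in n-1 variables
    per alphabet, for every i, so if f is in the ideal then R_{i+1} f - R_i f
    is z_i times an element of the smaller ideal; this element is supported on
    good monomials if f is, hence is 0. So inserting p unused variables at
    position i gives a coefficient of f independent of i, and since a good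
    monomial avoids the first p variables its whole support can be shifted down
    by p forever: f is constant, hence 0.

    Counting. Good sequences satisfy the ballot recursion. *)
From HB Require Import structures.
Require Import Defs.
From mathcomp Require Import all_boot all_order all_algebra.
From mathcomp Require Import mpoly boolp zify ring.

Set Implicit Arguments.
Unset Strict Implicit.
Unset Printing Implicit Defensive.

Import GRing.Theory.
Local Open Scope ring_scope.

(** * Polynomials and chain sums *)

Section Support.

Variables (N : nat) (K : comNzRingType).
Implicit Types (P Q : 'X_{1..N} -> Prop) (f g : {mpoly K[N]}).

Definition supp_in P f := forall m, m \in msupp f -> P m.

Lemma supp_inW P Q f : (forall m, P m -> Q m) -> supp_in P f -> supp_in Q f.
Proof. by move=> PQ Pf m /Pf/PQ. Qed.

Lemma supp_in0 P : supp_in P 0.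
Proof. by move=> m; rewrite msupp0. Qed.

Lemma supp_inD P f g : supp_in P f -> supp_in P g -> supp_in P (f + g).
Proof. by move=> Pf Pg m /msuppD_le; rewrite mem_cat => /orP [/Pf|/Pg]. Qed.

Lemma supp_inZ P a f : supp_in P f -> supp_in P (a *: f).
Proof. by move=> Pf m /msuppZ_le /Pf. Qed.

Lemma supp_inB P f g : supp_in P f -> supp_in P g -> supp_in P (f - g).
Proof. by move=> Pf Pg m /msuppB_le; rewrite mem_cat => /orP [/Pf|/Pg]. Qed.

Lemma supp_in_sum P (I : Type) (r : seq I) (C : pred I) (F : I -> {mpoly K[N]}) :
  (forall i, C i -> supp_in P (F i)) -> supp_in P (\sum_(i <- r | C i) F i).
Proof.
move=> PF; elim/big_rec: _ => [|i f /PF Pi Pf]; first exact: supp_in0.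
exact: supp_inD.
Qed.

Lemma supp_inM P Q (S : 'X_{1..N} -> Prop) f g :
  supp_in P f -> supp_in Q g ->
  (forall m1 m2, P m1 -> Q m2 -> S (m1 + m2)%MM) -> supp_in S (f * g).
Proof.
by move=> Pf Qg PQS m /msuppM_le /allpairsP [[m1 m2] /= [/Pf ? /Qg ? ->]]; apply: PQS.
Qed.

Lemma supp_inX P m : P m -> supp_in P 'X_[K, m].
Proof. by move=> Pm m'; rewrite msuppX inE => /eqP ->. Qed.

End Support.

(** Any natural number is allowed as an index, with value 0 beyond the last variable, so that sums
    over indices can be shifted and extended freely. *)
Definition zvar (N k : nat) : {mpoly rat[N]} :=
  if insub k is Some i then 'X_i else 0.

Lemma zvar_ord N (i : 'I_N) : zvar N i = 'X_i.
Proof. by rewrite /zvar valK. Qed.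

Lemma zvar_ge N k : (N <= k)%N -> zvar N k = 0.
Proof. by move=> leNk; rewrite /zvar insubF // ltnNge leNk. Qed.

Lemma supp_zvar N (k : nat) :
  supp_in (fun m => mdeg m = 1%N /\ forall j : 'I_N, m j = (k == j) :> nat) (zvar N k).
Proof.
case: (ltnP k N) => [ltkN|/zvar_ge ->]; last exact: supp_in0.
rewrite (zvar_ord (Ordinal ltkN)); apply: supp_inX; split=> [|j]; first exact: mdeg1.
by rewrite mnm1E -val_eqE.
Qed.

Definition zprod N (h : seq nat) : {mpoly rat[N]} := \prod_(k <- h) zvar N k.

Lemma supp_zprod N h :
  supp_in (fun m => mdeg m = size h /\
             forall j : 'I_N, m j = count_mem (j : nat) h) (zprod N h).
Proof.
rewrite /zprod; elim: h => [|k h IHh]; first rewrite big_nil -mpolyX0.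
  by apply: supp_inX; rewrite mdeg0; split=> // j; rewrite mnmE.
rewrite big_cons; apply: (supp_inM (@supp_zvar N k) IHh) => m1 m2 [d1 e1] [d2 e2].
by split=> [|j]; rewrite ?mdegD ?d1 ?d2 // mnmDE e1 e2.
Qed.

Section ChainSums.

Variables p n : nat.
Local Notation N := (n * p)%N.
Local Notation z := (zvar N).

(* The sum of the products of the z_{t_r + p b_r} over a <= b_0 <= b_1 <= ...;
   bounding the b_r by n loses nothing, as [zvar N k] is 0 for k >= N. *)
Fixpoint chain_sum (t : seq nat) (a : nat) : {mpoly rat[N]} :=
  if t is x :: t' then \sum_(a <= b < n) z (x + b * p) * chain_sum t' b else 1.

(** Splits off the term b = a; for a >= n both sides vanish, the variable being out of range. *)
Lemma chain_sum_cons x t a :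
  chain_sum (x :: t) a = z (x + a * p) * chain_sum t a + chain_sum (x :: t) a.+1.
Proof.
case: (ltnP a n) => [ltan|lena] /=; first by rewrite big_ltn.
by rewrite !big_geq 1?leqW // zvar_ge ?mul0r ?addr0 //; nia.
Qed.

Lemma chain_sum_shift t a : chain_sum [seq (p + x)%N | x <- t] a = chain_sum t a.+1.
Proof.
elim: t a => //= x t IHt a.
case: (ltnP a n) => [ltan|lena]; last by rewrite !big_geq // leqW.
(* Reindexing by b + 1 makes the range end at n + 1; the added term b = n contains a variable out of
   range. *)
transitivity (\sum_(a.+1 <= b < n.+1) z (x + b * p) * chain_sum t b); last first.
  by rewrite big_nat_recr //= [z (x + n * p)]zvar_ge ?leq_addl // mul0r addr0.
rewrite big_add1 /=.
by apply: eq_bigr => b _; rewrite IHt; congr (z _ * _); lia.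
Qed.

Lemma supp_chain_sum t a :
  supp_in (fun m => mdeg m = size t /\
     forall j : 'I_N, all (fun x => j < x + a * p)%N t -> m j = 0%N) (chain_sum t a).
Proof.
elim: t a => [|x t IHt] a /=.
  by rewrite -mpolyX0; apply: supp_inX; rewrite mdeg0; split=> // j; rewrite mnmE.
rewrite big_nat_cond; apply: supp_in_sum => b /andP [/andP [leab _] _].
apply: (supp_inM (@supp_zvar _ _) (IHt b)) => m1 m2 [d1 e1] [d2 e2].
split=> [|j /andP [ltjx ltjt]]; rewrite ?mdegD ?d1 ?d2 // mnmDE e1 e2 ?addn0.
  have leabp: (a * p <= b * p)%N by rewrite leq_mul2r leab orbT.
  by apply/eqP; rewrite eqb0; apply/eqP; lia.
by apply: sub_all ltjt => y /leq_trans; apply; rewrite leq_add2l leq_mul2r leab orbT.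
Qed.

End ChainSums.

Lemma mem_ideal_gen (K : comNzRingType) (A : comAlgType K) (S : A -> Prop) f :
  S f -> f \in ideal_gen S.
Proof.
move=> Sf; apply/asboolP; exists [:: (1, f)]; last by rewrite big_seq1 mul1r.
by move=> x; rewrite inE => /eqP ->.
Qed.

(** * Spanning by good monomials *)

(** A gap above p between consecutive run indices would leave p consecutive empty runs. *)
Definition spread (p : nat) : rel nat := fun x y => (x <= y <= x + p)%N.

(** For sorted s this is the ballot condition s_r >= (r + 1) p for each r below the length. *)
Definition good (p : nat) (s : seq nat) :=
  forall r, (count (fun x => x < r.+1 * p) s <= r)%N.

Lemma good_sub p h t :
  good p (h ++ [seq (y - p)%N | y <- t]) -> good p (h ++ t).
Proof.
move=> gd r; apply: leq_trans (gd r); rewrite !count_cat leq_add2l count_map.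
by apply: sub_count => y /=; apply: leq_ltn_trans; apply: leq_subr.
Qed.

(** At thresholds up to x, only h is counted in [h ++ x :: t]. At a threshold (r + 1) p > x, the
    entry x adds one, and the rest is bounded by the count at r p after the subtraction, where all
    of h is counted. *)
Lemma good_drop p h x t :
    (p <= x)%N -> all (fun y => y + p < x)%N h -> all (leq x) t ->
  good p (h ++ [seq (y - p)%N | y <- t]) -> good p (h ++ x :: t).
Proof.
move=> le_px lt_hx le_xt gd r; rewrite count_cat /=.
case: (ltnP x (r.+1 * p)) => [lt_xr|le_rx]; last first.
  rewrite add0n [X in (_ + X)%N](_ : _ = 0)%N ?addn0.
    by apply: leq_trans (gd r); rewrite count_cat leq_addr.
  apply/eqP; rewrite -leqn0 leqNgt -has_count -all_predC.
  by apply: sub_all le_xt => y /= le_xy; rewrite -leqNgt (leq_trans le_rx).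
case: r lt_xr => [|r] lt_xr; first by rewrite mul1n ltnNge le_px in lt_xr.
rewrite add1n addnS ltnS; apply: leq_trans (gd r); rewrite count_cat; apply: leq_add.
  suff /eqP -> : count (fun y => y < r.+1 * p)%N h == size h by apply: count_size.
  by rewrite -all_count; apply: sub_all lt_hx => y; rewrite (mulSn r.+1) in lt_xr; lia.
rewrite count_map; apply: sub_count => y /=; rewrite (mulSn r.+1); lia.
Qed.

(* The order is lexicographic on exponents, the variable of index 0 being the
   largest: m is then smaller than every multiple of the monomial of h. *)
Definition lex_below N (h : seq nat) (m : 'X_{1..N}) :=
  exists k : 'I_N, (forall j : 'I_N, j < k -> m j = count_mem (j : nat) h)%N /\
                   (m k < count_mem (k : nat) h)%N.

Section UpperBound.

Variables (p n : nat) (p_gt0 : (0 < p)%N).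
Local Notation N := (n * p)%N.
Local Notation z := (zvar N).
Variable S : {mpoly rat[N]} -> Prop.

Hypothesis chain_sumS : forall x t, (x < p)%N -> path (spread p) x t ->
  chain_sum p n (x :: t) 0 \in ideal_gen S.

(** Nothing lies below the empty sequence, so for [h = [::]] this says that f is in the ideal. *)
Definition reducible (h : seq nat) (d : nat) (f : {mpoly rat[N]}) :=
  exists2 g, g \in ideal_gen S &
    supp_in (fun m => mdeg m = d /\ lex_below h m) (zprod N h * f - g).

Lemma reducibleB h d f1 f2 :
  reducible h d f1 -> reducible h d f2 -> reducible h d (f1 - f2).
Proof.
move=> [g1 g1I s1] [g2 g2I s2]; exists (g1 - g2); first exact: rpredB.
have -> : zprod N h * (f1 - f2) - (g1 - g2) =
  zprod N h * f1 - g1 - (zprod N h * f2 - g2) by ring.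
exact: supp_inB.
Qed.

(** The index deciding a comparison with h occurs in h, hence precedes t, so the factor z_t does not
    affect the comparison. *)
Lemma reducible_mulz h d f t : all (fun y => y < t)%N h ->
  reducible h d f -> reducible h d.+1 (z t * f).
Proof.
move=> lt_ht [g gI sg]; exists (z t * g); first exact: ideal_genMl.
rewrite mulrCA -mulrBr.
apply: (supp_inM (@supp_zvar _ t) sg) => m1 m2 [d1 e1] [d2 [k [eqk ltk]]].
have lt_kt : (k < t)%N.
  have := allP lt_ht k; apply; rewrite -has_pred1 has_count.
  exact: leq_ltn_trans ltk.
split; first by rewrite mdegD d1 d2.
exists k; split=> [j ltjk|]; rewrite mnmDE e1 gtn_eqF //; first by rewrite eqk.
by move: ltjk lt_kt; apply: ltn_trans.
Qed.

(** The error term [zprod N h * g] is below [rcons h y]: its monomials agree with h up to index y,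
    so they have one factor z_y too few. *)
Lemma reducible_rcons h y d f g :
    all (fun x => x <= y)%N h ->
    supp_in (fun m => mdeg m + size h = d /\ forall j : 'I_N, (j <= y)%N -> m j = 0)%N g ->
  reducible h d (z y * f + g) -> reducible (rcons h y) d f.
Proof.
move=> le_hy sg [q qI sq]; have zE : zprod N (rcons h y) * f = zprod N h * (z y * f).
  by rewrite /zprod -cats1 big_cat big_seq1 mulrA.
case: (ltnP y N) => [lt_yN|/zvar_ge z0]; last first.
  by exists 0; rewrite ?rpred0 // zE z0 mul0r mulr0 subrr; apply: supp_in0.
exists q => //; rewrite zE -[_ * _](addrK (zprod N h * g)) -mulrDr addrAC.
apply: supp_inB => [m /sq [dm [k [eqk ltk]]]|].
  split=> //; have le_ky : (k <= y)%N.
    have := allP le_hy k; apply; rewrite -has_pred1 has_count.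
    exact: leq_ltn_trans ltk.
  exists k; split=> [j ltjk|]; rewrite -cats1 count_cat /=; last first.
    exact: leq_trans ltk (leq_addr _ _).
  by rewrite gtn_eqF ?addn0 ?eqk //; apply: leq_trans le_ky.
apply: (supp_inM (@supp_zprod N h) sg) => m1 m2 [d1 e1] [d2 e2].
split; first by rewrite mdegD d1 addnC.
exists (Ordinal lt_yN); split=> [j /= ltjy|]; rewrite mnmDE e1 e2 //= -?cats1 ?count_cat //=.
  by rewrite gtn_eqF // 1?ltnW.
  exact: ltnW.
by rewrite eqxx; lia.
Qed.

(** With T for [x :: t], F_T = F_{T-p} - z_{x-p} F_{t-p}, and the index x - p exceeds all of h. *)
Lemma reducible_peel h d x t :
    (p <= x)%N -> all (fun y => y + p < x)%N h -> path (spread p) x t ->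
    reducible h d (chain_sum p n [seq (y - p)%N | y <- t] 0) ->
    reducible h d.+1 (chain_sum p n [seq (y - p)%N | y <- x :: t] 0) ->
  reducible h d.+1 (chain_sum p n (x :: t) 0).
Proof.
move=> le_px lt_hx xt red1 red2.
have -> : x :: t = [seq (p + y)%N | y <- [seq (y - p)%N | y <- x :: t]].
  rewrite -map_comp map_id_in // => y ytx /=; rewrite subnKC //.
  apply: leq_trans le_px _.
  have : path leq x t by apply: sub_path xt => u v /andP [].
  rewrite (path_sortedE leq_trans) => /andP [/allP all_x _].
  by move: ytx; rewrite inE => /orP [/eqP -> //|/all_x].
rewrite chain_sum_shift.
have -> : chain_sum p n [seq (y - p)%N | y <- x :: t] 1 =
  chain_sum p n [seq (y - p)%N | y <- x :: t] 0
  - z (x - p) * chain_sum p n [seq (y - p)%N | y <- t] 0.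
  by rewrite [map _ (x :: t)]/= (@chain_sum_cons p n _ _ 0) mul0n addn0 addrC addKr.
apply: reducibleB red2 _; apply: reducible_mulz red1.
by apply: sub_all lt_hx => y; lia.
Qed.

(* For t = [::] this says that the non-good monomial h is congruent to a
   combination of smaller ones; a nonempty t makes the induction work. *)
Lemma chain_reducible h t :
    pairwise leq (h ++ t) -> sorted (spread p) t -> ~ good p (h ++ t) ->
  reducible h (size h + size t) (chain_sum p n t 0).
Proof.
(* Three nested inductions: on the total length, on h from its last entry, and on the first entry of
   t. *)
have [k] := ubnP (size h + size t); elim: k h t => // k IHk.
(* Of the two terms given by [reducible_peel], the one without x has smaller total length; the
   other, with smaller first entry, is left to the hypothesis [IHx]. *)
have peel h x t : (size h + size (x :: t) < k.+1)%N -> (p <= x)%N ->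
    all (fun y => y + p < x)%N h ->
    (pairwise leq (h ++ [seq (y - p)%N | y <- x :: t]) ->
      sorted (spread p) [seq (y - p)%N | y <- x :: t] ->
      ~ good p (h ++ [seq (y - p)%N | y <- x :: t]) ->
      reducible h (size h + size (x :: t))
        (chain_sum p n [seq (y - p)%N | y <- x :: t] 0)) ->
    pairwise leq (h ++ x :: t) -> path (spread p) x t -> ~ good p (h ++ x :: t) ->
  reducible h (size h + size (x :: t)) (chain_sum p n (x :: t) 0).
  move=> lt_k le_px lt_hx IHx; rewrite pairwise_cat => /and3P [_ hP xtP] xtS ng.
  have shiftP : pairwise leq [seq (y - p)%N | y <- x :: t].
    by rewrite pairwise_map; apply: sub_pairwise xtP => u v; apply: leq_sub2r.
  have shiftS : sorted (spread p) [seq (y - p)%N | y <- x :: t].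
    by rewrite sorted_map; apply: sub_path xtS => u v; rewrite /spread /=; lia.
  have all_x : all (leq x) t by move: xtP => /= /andP [].
  have hshiftP : pairwise leq (h ++ [seq (y - p)%N | y <- x :: t]).
    rewrite pairwise_cat hP shiftP !andbT; apply/allrelP => u v /(allP lt_hx) lt_ux.
    case/mapP=> w wxt ->; suff : (x <= w)%N by lia.
    by move: wxt; rewrite inE => /orP [/eqP ->|/(allP all_x)].
  have sz : (size h + size (x :: t) = (size h + size t).+1)%N by rewrite addnS.
  rewrite {}sz in IHx *; apply: reducible_peel => //; last first.
    by apply: IHx => // /good_sub.
  rewrite -(size_map (subn^~ p) t); apply: IHk.
  - by rewrite size_map; move: lt_k => /=; lia.
  - move: hshiftP; rewrite !pairwise_cat /= allrel_consr.
    by move=> /and3P [/andP [_ ->] -> /andP [_ ->]].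
  - exact: path_sorted shiftS.
  - by move/(good_drop le_px lt_hx all_x).
elim/last_ind=> [|h y IHh].
  case=> [|x t]; first by move=> _ _ _ [].
  have [m] := ubnP x; elim: m x t => // m IHm x t lt_xm lt_k hP xtS ng.
  case: (ltnP x p) => [lt_xp|le_px].
    exists (chain_sum p n (x :: t) 0); first exact: chain_sumS.
    by rewrite /zprod big_nil mul1r subrr; apply: supp_in0.
  apply: peel => // hP' xtS' ng'; rewrite -(size_map (subn^~ p) (x :: t)).
  by apply: (IHm (x - p)%N [seq (y - p)%N | y <- t]) => //=; [lia | rewrite size_map].
(* If t' may follow y, then y moves from the end of h to the front of t'; the other terms of the
   chain sum of [y :: t'] only have variables of index above y. *)
move=> t; have graft t' : (size (rcons h y) + size t' < k.+1)%N -> path (spread p) y t' ->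
    pairwise leq (rcons h y ++ t') -> ~ good p (rcons h y ++ t') ->
  reducible (rcons h y) (size (rcons h y) + size t') (chain_sum p n t' 0).
  rewrite size_rcons cat_rcons addSnnS => lt_k yt' hP ng.
  apply: (@reducible_rcons h y _ _ (chain_sum p n (y :: t') 1)).
  - move: hP; rewrite pairwise_cat allrel_consr => /and3P [/andP [+ _] _ _].
    exact: sub_all.
  - move=> m /(@supp_chain_sum p n) [-> m0]; split=> [|j le_jy]; first by rewrite addnC.
    apply: m0; rewrite mul1n; apply/allP => u uy.
    suff le_yu : (y <= u)%N by lia.
    move: uy; rewrite inE => /orP [/eqP -> //|]; move: u; apply/allP.
    by move: hP; rewrite pairwise_cat /= => /and3P [_ _ /andP []].
  - have -> : z y = z (y + 0 * p) by rewrite mul0n addn0.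
    rewrite -chain_sum_cons.
    exact: IHh.
case: t => [|x t]; first by move=> *; apply: graft.
have [m] := ubnP x; elim: m x t => // m IHm x t lt_xm lt_k hP xtS ng.
case: (leqP x (y + p)) => [le_xy|lt_yx].
  apply: graft => //; apply/andP; split=> //; rewrite /spread le_xy andbT.
  by move: hP; rewrite pairwise_cat allrel_consr all_rcons => /and3P [/andP [/andP []]].
apply: peel => //; first by lia.
  rewrite all_rcons lt_yx /=; apply/allP => u hu; apply: leq_ltn_trans lt_yx.
  rewrite leq_add2r; move: hP; rewrite -cats1 -catA pairwise_cat allrel_consr.
  by move=> /and3P [/andP [/allP all_y _] _ _]; apply: all_y.
move=> hP' xtS' ng'; rewrite -(size_map (subn^~ p) (x :: t)).
by apply: (IHm (x - p)%N [seq (y - p)%N | y <- t]) => //=; [lia | rewrite size_map].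
Qed.

End UpperBound.

(** * Monomials as sorted sequences of variable indices *)

Section MonomialSeq.

Variable N : nat.
Implicit Type m : 'X_{1..N}.

Definition mseq m : seq nat :=
  sort leq (flatten [seq nseq (m i) (i : nat) | i <- enum 'I_N]).

Lemma count_mseq (a : pred nat) m : count a (mseq m) = (\sum_(i < N | a i) m i)%N.
Proof.
rewrite count_sort count_flatten sumnE 2!big_map big_enum /= [RHS]big_mkcond.
by apply: eq_bigr => i _; rewrite count_nseq; case: ifP => _; rewrite ?mul1n ?mul0n.
Qed.

Lemma count_mem_mseq m (i : 'I_N) : count_mem (i : nat) (mseq m) = m i.
Proof.
by rewrite count_mseq (eq_bigl (pred1 i)) ?big_pred1_eq.
Qed.

Lemma size_mseq m : size (mseq m) = mdeg m.
Proof. by rewrite -count_predT count_mseq mdegE. Qed.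

Lemma zprod_mseq m : zprod N (mseq m) = 'X_[m].
Proof.
rewrite /zprod (perm_big _ (permEl (perm_sort _ _))) /= big_flatten big_map big_enum /=.
rewrite mpolyXE_id; apply: eq_bigr => i _.
by rewrite big_nseq -zvar_ord iter_mulr_1.
Qed.

Lemma lex_below_lt m m' : mdeg m' = mdeg m -> lex_below (mseq m) m' -> (m' < m)%O.
Proof.
move=> dm [k [eqk ltk]]; apply/ltmcP => //; exists k.
  by move=> j /eqk ->; rewrite count_mem_mseq.
by move: ltk; rewrite count_mem_mseq.
Qed.

End MonomialSeq.

Definition good_monomial p N (m : 'X_{1..N}) := good p (mseq m).

(** Well-founded induction on monomials: by [chain_reducible] with t empty, a non-good one is
    congruent to a combination of smaller ones. *)
Lemma good_span p n (p_gt0 : (0 < p)%N) (S : {mpoly rat[n * p]} -> Prop) :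
    (forall x t, (x < p)%N -> path (spread p) x t ->
       chain_sum p n (x :: t) 0 \in ideal_gen S) ->
  forall f, exists2 g, supp_in (@good_monomial p _) g & f - g \in ideal_gen S.
Proof.
move=> chS; have spanD f1 f2 :
    (exists2 g, supp_in (@good_monomial p _) g & f1 - g \in ideal_gen S) ->
    (exists2 g, supp_in (@good_monomial p _) g & f2 - g \in ideal_gen S) ->
  exists2 g, supp_in (@good_monomial p _) g & f1 + f2 - g \in ideal_gen S.
  move=> [g1 s1 I1] [g2 s2 I2]; exists (g1 + g2); first exact: supp_inD.
  by rewrite opprD addrACA rpredD.
have spanS f (P : 'X_{1..n * p} -> Prop) : supp_in P f ->
    (forall m, P m -> exists2 g, supp_in (@good_monomial p _) g &
       'X_[m] - g \in ideal_gen S) ->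
  exists2 g, supp_in (@good_monomial p _) g & f - g \in ideal_gen S.
  move=> Pf spanP; rewrite [f]mpolyE big_seq; elim/big_ind: _ => [||m /Pf/spanP].
  - by exists 0; [exact: supp_in0 | rewrite subrr rpred0].
  - exact: spanD.
  move=> [g sg gI]; exists (f@_m *: g); first exact: supp_inZ.
  by rewrite -scalerBr -mul_mpolyC; apply: ideal_genMl.
suff spanX m : exists2 g, supp_in (@good_monomial p _) g & 'X_[m] - g \in ideal_gen S.
  by move=> f; apply: (spanS f (fun=> True)) => //.
elim/(well_founded_induction (@ltom_wf (n * p))): m => m IHm.
case: (pselect (good_monomial p m)) => [gm|ngm].
  by exists 'X_[m]; [exact: supp_inX | rewrite subrr rpred0].
have := @chain_reducible p n p_gt0 S chS (mseq m) [::]; rewrite cats0 addn0 size_mseq.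
case=> // [|g gI sg].
  by rewrite -(sorted_pairwise leq_trans); apply: sort_sorted leq_total _.
rewrite zprod_mseq mulr1 in sg.
have [m' [dm' ltm]|q sq qI] := spanS _ _ sg.
  by apply: IHm; apply: lex_below_lt.
exists q => //; have -> : 'X_[m] - q = 'X_[m] - g - q + g by ring.
exact: rpredD.
Qed.

(** * Fundamental polynomials as chain sums *)

Lemma index_allpairs (T1 T2 : eqType) (s : seq T1) (t : seq T2) x y :
  x \in s -> y \in t ->
  index (x, y) [seq (a, b) | a <- s, b <- t] = (index x s * size t + index y t)%N.
Proof.
move=> + ty; elim: s => //= a s IHs; rewrite inE index_cat.
have pair_inj : injective (pair a : T2 -> T1 * T2) by move=> u v [].
case: (eqVneq x a) => [-> _|nxa /= xs].
  by rewrite (mem_map pair_inj) ty (index_map pair_inj).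
rewrite ifN; last first.
  by apply/mapP=> -[b _ [/eqP]]; rewrite (negPf nxa).
by rewrite size_map IHs // mulSn addnA.
Qed.

(** Pairs are enumerated row by row, which is the block by block numbering of the variables. *)
Lemma mxvec_indexE m n (i : 'I_m) (j : 'I_n) : mxvec_index i j = (i * n + j)%N :> nat.
Proof.
rewrite /mxvec_index /=; have /(congr1 (index^~ (enum {: 'I_m * 'I_n}))) :=
  nth_enum_rank (i, j) (i, j).
rewrite index_uniq ?enum_uniq -?cardE // => ->.
rewrite enumT unlock /= index_allpairs ?mem_enum // !index_enum_ord.
by rewrite -cardE card_ord.
Qed.

Lemma xvarE p n (s : 'I_p) (i : 'I_n) : xvar s i = zvar (n * p) (i * p + s).
Proof. by rewrite -mxvec_indexE zvar_ord. Qed.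

(** This is the sequence t attached to c; it determines c up to trailing zeros. *)
Definition runs (c : seq nat) := mkseq (reshape_index c) (sumn c).

Lemma reshape_index_homo c r r' :
  (r <= r')%N -> (reshape_index c r <= reshape_index c r')%N.
Proof. by rewrite (reshape_leq c) => /orP [/ltnW|/andP [/eqP ->]]. Qed.

Lemma sorted_runs c : sorted leq (runs c).
Proof.
apply/(sortedP 0%N) => i; rewrite size_mkseq => lt_i; rewrite !nth_mkseq ?(ltnW lt_i) //.
exact: reshape_index_homo.
Qed.

Lemma runs_cons k c : runs (k :: c) = nseq k 0%N ++ [seq r.+1 | r <- runs c].
Proof.
rewrite /runs /mkseq /= iotaD map_cat; congr (_ ++ _).
  apply: (@eq_from_nth _ 0%N) => [|i]; rewrite size_map size_iota ?size_nseq // => ltik.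
  by rewrite nth_nseq ltik nth_mkseq // /reshape_index /= subn_eq0 ltik.
rewrite add0n -[k in iota k]addn0 iotaDl -!map_comp; apply: eq_map => i /=.
by rewrite /reshape_index /= subn_eq0 ltnNge leq_addr /= -addnS addKn.
Qed.

Lemma count_mem_runs c j : count_mem j (runs c) = nth 0%N c j.
Proof.
elim: c j => [|k c IHc] j; first by rewrite nth_nil.
rewrite runs_cons count_cat count_nseq count_map; case: j => [|j] /=.
  by rewrite mul1n (eq_count (a2 := pred0)) ?count_pred0 ?addn0.
by rewrite mul0n -IHc; apply: eq_count => i.
Qed.

Lemma nth_gt0_run c j : (0 < nth 0 c j)%N ->
  exists2 r, reshape_index c r = j & (r < sumn c)%N.
Proof.
move=> cj; exists (flatten_index c j 0); first exact: flatten_indexKl.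
exact: flatten_indexP.
Qed.

Lemma nseq0_infix p c j : (j + p <= size c)%N ->
  (forall i, (j <= i < j + p)%N -> nth 0%N c i = 0%N) -> infix (nseq p 0%N) c.
Proof.
move=> lejp c0; rewrite -(cat_take_drop j c) -(cat_take_drop p (drop j c)).
suff -> : take p (drop j c) = nseq p 0%N by apply: infix_infix.
have sz : size (take p (drop j c)) = p by rewrite size_takel // size_drop; lia.
apply: (@eq_from_nth _ 0%N) => [|i]; rewrite sz ?size_nseq // => ltip.
by rewrite nth_nseq ltip nth_take // nth_drop c0 //; lia.
Qed.

(** An index skipped by [runs] is a zero entry of c, so a gap above p, or a first index of at least
    p, exhibits p consecutive zeros. *)
Lemma runs_spread p c : ~~ infix (nseq p 0%N) c ->
  sorted (spread p) (runs c) /\ (0 < sumn c -> reshape_index c 0 < p)%N.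
Proof.
move=> ninf; split=> [|c_gt0].
  apply/(sortedP 0%N) => i; rewrite size_mkseq => lt_i.
  rewrite !nth_mkseq ?(ltnW lt_i) // /spread reshape_index_homo //=.
  rewrite leqNgt; apply: contra ninf => lt_gap.
  apply: (@nseq0_infix _ _ (reshape_index c i).+1).
    by have := reshape_indexP lt_i; lia.
  move=> j /andP [lt_j le_j]; apply/eqP; rewrite -leqn0 leqNgt.
  apply/negP => /nth_gt0_run [r rj _]; case: (leqP r i) => /(reshape_index_homo c); lia.
rewrite ltnNge; apply: contra ninf => le_p; apply: (@nseq0_infix _ _ 0).
  by have := reshape_indexP c_gt0; lia.
move=> j /andP [_ le_j]; apply/eqP; rewrite -leqn0 leqNgt.
by apply/negP => /nth_gt0_run [r rj _]; have := reshape_index_homo c (leq0n r); lia.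
Qed.

(** Steps of at most p cannot jump over p consecutive values. *)
Lemma spread_visits p x t j : path (spread p) x t -> (x < j + p)%N ->
  (j <= last x t)%N -> has (fun y => j <= y < j + p)%N (x :: t).
Proof.
elim: t x => [|y t IHt] x /=; first by rewrite orbF => _ -> ->.
move=> /andP [/andP [_ le_yx] yt] lt_x le_last; rewrite lt_x andbT.
case: (leqP j x) => //= lt_xj; apply: IHt => //; lia.
Qed.

Lemma spread_runs p x t : (0 < p)%N -> (x < p)%N -> path (spread p) x t ->
  exists2 c, pcomposition p c & runs c = x :: t.
Proof.
(* K blocks just reach the last index, so fewer than p zeros are padded at the end of c. *)
move=> p_gt0 lt_xp xt; pose K := (last x t %/ p).+1.
have st : sorted leq (x :: t) by apply: sub_path xt => u v /andP [].
have lt_lastK : (last x t < p * K)%N by rewrite mulnC ltn_ceil.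
pose c := mkseq (fun j => count_mem j (x :: t)) (p * K).
have nth_c j : nth 0%N c j = count_mem j (x :: t).
  case: (ltnP j (p * K)) => [ltj|lej]; first by rewrite nth_mkseq.
  rewrite nth_default ?size_mkseq //; apply/esym/count_memPn.
  apply/negP => /(nthP 0%N) [i lti ij].
  have := sorted_leq_nth leq_trans leqnn 0%N st i (size t) lti (ltnSn _) lti.
  by rewrite (nth_last 0%N (x :: t)) /= ij; lia.
exists c; last first.
  apply: (sorted_eq leq_trans anti_leq (sorted_runs c) st).
  by apply/allP => j _ /=; rewrite count_mem_runs nth_c.
rewrite /pcomposition size_mkseq dvdn_mulr //=; apply/negP.
move=> /infixP [s1 [s2 c_eq]].
have sz : (size s1 + p <= p * K)%N.
  by have := congr1 size c_eq; rewrite size_mkseq !size_cat size_nseq; lia.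
have /hasP [y yt /andP [le_y lt_y]] : has (fun y => size s1 <= y < size s1 + p)%N (x :: t).
  apply: spread_visits xt _ _; first by lia.
  by have := leq_trunc_div (last x t) p; rewrite /K in sz; nia.
have lt_yp : (y - size s1 < p)%N by lia.
have /count_memPn : count_mem y (x :: t) = 0%N; last by rewrite yt.
by rewrite -nth_c c_eq nth_cat ltnNge le_y /= nth_cat size_nseq lt_yp nth_nseq lt_yp.
Qed.

Section Fundamental.

Variables (p n : nat) (p_gt0 : (0 < p)%N).
Local Notation z := (zvar (n * p)).

(** Admissibility for a run sequence rho, together with b_0 >= a under the change of variables m_r =
    rho_r / p + b_r (integer quotient). *)
Definition chainb d (rho : nat -> nat) (a : nat) (m : {ffun 'I_d -> 'I_n}) :=
  [forall r : 'I_d, forall r' : 'I_d, (r' == r.+1 :> nat) ==>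
     (if rho r %/ p == rho r' %/ p then m r <= m r' else m r < m r')%N] &&
  [forall r : 'I_d, (r == 0 :> nat)%N ==> (rho 0 %/ p + a <= m r)%N].

Definition ffun_cons d (x : 'I_n) (f : {ffun 'I_d -> 'I_n}) : {ffun 'I_d.+1 -> 'I_n} :=
  [ffun i => oapp f x (unlift ord0 i)].

Lemma ffun_cons0 d x (f : {ffun 'I_d -> 'I_n}) : ffun_cons x f ord0 = x.
Proof. by rewrite ffunE unlift_none. Qed.

Lemma ffun_consS d x (f : {ffun 'I_d -> 'I_n}) i : ffun_cons x f (lift ord0 i) = f i.
Proof. by rewrite ffunE liftK. Qed.

Lemma big_ffun_cons d (P : pred {ffun 'I_d.+1 -> 'I_n}) (V : nmodType)
    (F : {ffun 'I_d.+1 -> 'I_n} -> V) :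
  \sum_(m | P m) F m = \sum_(x : 'I_n) \sum_(f | P (ffun_cons x f)) F (ffun_cons x f).
Proof.
rewrite pair_big_dep /=.
rewrite (reindex (fun xf : 'I_n * {ffun 'I_d -> 'I_n} => ffun_cons xf.1 xf.2)) //.
exists (fun m : {ffun 'I_d.+1 -> 'I_n} =>
          (m ord0, [ffun i : 'I_d => m (lift ord0 i)])) => [[x f] _|m _] /=.
  by rewrite ffun_cons0; congr pair; apply/ffunP => i; rewrite ffunE ffun_consS.
apply/ffunP => i; case: (unliftP ord0 i) => [j ->|->]; last by rewrite ffun_cons0.
by rewrite ffun_consS ffunE.
Qed.

Lemma spread_div u v : spread p u v -> (u %/ p <= v %/ p <= (u %/ p).+1)%N.
Proof.
move=> /andP [/(leq_div2r p) -> /(leq_div2r p)].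
by rewrite divnDr ?dvdnn // divnn p_gt0 addn1.
Qed.

(** The quotient rho_r / p grows by 0 or 1 at each step, so the weak and the strict inequality both
    say that m_r - rho_r / p does not decrease. *)
Lemma chainb_cons d rho a x (f : {ffun 'I_d -> 'I_n}) :
    (0 < d -> spread p (rho 0) (rho 1))%N ->
  chainb rho a (ffun_cons x f) =
  (rho 0 %/ p + a <= x)%N && chainb (rho \o succn) (x - rho 0 %/ p) f.
Proof.
move=> sp; apply/idP/idP.
  move=> /andP [/forallP chm /forallP fm].
  have lex : (rho 0 %/ p + a <= x)%N by have := fm ord0; rewrite ffun_cons0.
  rewrite lex /=; apply/andP; split.
    apply/forallP => r; apply/forallP => r'.
    by have /forallP/(_ (lift ord0 r')) := chm (lift ord0 r); rewrite !ffun_consS !lift0.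
  apply/forallP => r; apply/implyP => /eqP r0.
  have /forallP/(_ (lift ord0 r)) := chm ord0; rewrite ffun_cons0 ffun_consS lift0 r0 /=.
  have /spread_div := sp (leq_ltn_trans (leq0n r) (ltn_ord r)).
  by case: eqP; lia.
move=> /and3P [lex /forallP chf /forallP ff]; apply/andP; split; last first.
  apply/forallP => r; apply/implyP => /eqP r0.
  by rewrite (_ : r = ord0) ?ffun_cons0 //; apply: val_inj.
apply/forallP => r; apply/forallP => r'; apply/implyP.
case: (unliftP ord0 r') => [s' ->|->] //; rewrite lift0 eqSS ffun_consS.
case: (unliftP ord0 r) => [s ->|->].
  by rewrite lift0 ffun_consS; have /forallP/(_ s')/implyP := chf s.
move=> /eqP s0; have := ff s'; rewrite s0 /= ffun_cons0.
have /spread_div := sp (leq_ltn_trans (leq0n s') (ltn_ord s')).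
by case: eqP; lia.
Qed.

Lemma sum_chainb d rho a : (forall r, (r.+1 < d)%N -> spread p (rho r) (rho r.+1)) ->
  \sum_(m : {ffun 'I_d -> 'I_n} | chainb rho a m)
     \prod_(r < d) z (m r * p + rho r %% p) = chain_sum p n (mkseq rho d) a.
Proof.
elim: d rho a => [|d IHd] rho a sp.
  rewrite (big_pred1 (ffun0 (card_ord 0))) ?big_ord0 // => m.
  transitivity true; last by apply/esym/eqP/ffunP => -[].
  by apply/andP; split; apply/forallP => -[].
rewrite big_ffun_cons; set q := (rho 0 %/ p)%N.
have -> : mkseq rho d.+1 = rho 0 :: mkseq (rho \o succn) d.
  by rewrite /mkseq /= -[1%N]addn0 iotaDl -map_comp.
transitivity (\sum_(q + a <= x < n)
    z (x * p + rho 0 %% p) * chain_sum p n (mkseq (rho \o succn) d) (x - q)).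
  rewrite big_geq_mkord [RHS]big_mkcond; apply: eq_bigr => x _ /=.
  have sp0 : (0 < d -> spread p (rho 0) (rho 1))%N by move=> d_gt0; apply: sp.
  rewrite (eq_bigl _ _ (fun f => chainb_cons a x f sp0)); case: ifP => lex.
    rewrite -IHd => [|r ltr]; last exact: sp.
    rewrite mulr_sumr; apply: eq_bigr => f _; rewrite big_ord_recl ffun_cons0.
    by congr (_ * _); apply: eq_bigr => r _; rewrite ffun_consS.
  by rewrite big_pred0.
(* With b = x - q, the bound x < n only allows b < n - q; the remaining terms of [chain_sum] vanish,
   their first variable being out of range. *)
have [k] := ubnP (n - a); elim: k a => // k IHk a lt_k.
case: (leqP n a) => [le_na|lt_an].
  by rewrite /= !big_geq //; lia.
rewrite chain_sum_cons -IHk; last by lia.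
have rhoE : (rho 0 + a * p = (q + a) * p + rho 0 %% p)%N.
  by rewrite mulnDl addnAC -divn_eq.
rewrite {}rhoE; case: (ltnP (q + a) n) => [ltqa|leqa].
  by rewrite big_ltn // addKn addnS.
by rewrite !big_geq ?zvar_ge ?mul0r ?addr0 //; nia.
Qed.

Lemma fundamentalE c : pcomposition p c ->
  fundamental n p_gt0 c = chain_sum p n (runs c) 0.
Proof.
case/andP=> _ /runs_spread [sp sp0]; rewrite /runs -sum_chainb.
  apply: eq_big => [m|m _]; last by apply: eq_bigr => r _; rewrite xvarE.
  (* The lower bound in [chainb] is 0 here, the first run index being below p. *)
  apply/esym/andb_idr => _; apply/forallP => r; apply/implyP => _; rewrite addn0.
  by rewrite divn_small ?sp0 //; apply: leq_ltn_trans (ltn_ord r).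
move=> r ltr; move/(sortedP 0%N)/(_ r): sp; rewrite size_mkseq !nth_mkseq ?(ltnW ltr) //.
exact.
Qed.

End Fundamental.

(** * Linear independence of good monomials *)

Definition mon N (h : seq nat) : 'X_{1..N} := [multinom count_mem (k : nat) h | k < N].

Lemma eq_mon N h1 h2 : perm_eq h1 h2 -> mon N h1 = mon N h2.
Proof. by move=> /permP eqh; apply/mnmP => k; rewrite !mnmE eqh. Qed.

Lemma mseqK N : cancel (@mseq N) (mon N).
Proof. by move=> m; apply/mnmP => k; rewrite mnmE count_mem_mseq. Qed.

Lemma mseq_ltn N (m : 'X_{1..N}) : all (ltn^~ N) (mseq m).
Proof.
apply/allP => k; rewrite mem_sort => /flattenP [s /mapP [i _ ->]].
by rewrite mem_nseq => /andP [_ /eqP ->]; apply: ltn_ord.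
Qed.

Lemma perm_mseq_mon N h : all (ltn^~ N) h -> perm_eq (mseq (mon N h)) h.
Proof.
move=> /allP lt_h; apply/allP => k /= _; apply/eqP.
case: (ltnP k N) => [ltk|lek].
  by have := count_mem_mseq (mon N h) (Ordinal ltk); rewrite mnmE.
rewrite !(count_memPn _) //; first by apply/negP => /lt_h /=; rewrite ltnNge lek.
by apply/negP => /(allP (mseq_ltn _)) /=; rewrite ltnNge lek.
Qed.

Lemma zprod_mon N h : all (ltn^~ N) h -> zprod N h = 'X_[mon N h].
Proof.
move=> lt_h; rewrite -zprod_mseq; apply: perm_big.
by rewrite perm_sym perm_mseq_mon.
Qed.

Lemma good_perm p s t : perm_eq s t -> good p s -> good p t.
Proof. by move=> /permP eq_st gs r; rewrite -eq_st. Qed.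

(** * Setting p consecutive variables to zero *)

Section Contraction.

Variables (p n : nat) (p_gt0 : (0 < p)%N).
Local Notation z := (zvar (n * p)).

Definition contract_var (i k : nat) : {mpoly rat[n * p]} :=
  if (k < i)%N then z k else if (k < i + p)%N then 0 else z (k - p).

(** This is the substitution R_i. *)
Definition contract (i : nat) : {mpoly rat[n.+1 * p]} -> {mpoly rat[n * p]} :=
  comp_mpoly [tuple contract_var i k | k < n.+1 * p].

HB.instance Definition _ i := GRing.LRMorphism.on (contract i).

Lemma contract_zvar i k : (i <= n * p)%N ->
  contract i (zvar (n.+1 * p) k) = contract_var i k.
Proof.
move=> le_i; case: (ltnP k (n.+1 * p)) => [ltk|lek].
  rewrite (zvar_ord (Ordinal ltk)) /contract comp_mpolyXU.
  by rewrite -tnth_nth tnth_mktuple.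
rewrite zvar_ge // rmorph0 /contract_var; rewrite mulSn in lek.
by rewrite !ifF ?zvar_ge //; lia.
Qed.

Lemma contract_chain_ge i t a : (i <= n * p)%N ->
    all (fun x => i <= x + a * p)%N t ->
  contract i (chain_sum p n.+1 t a.+1) = chain_sum p n t a.
Proof.
move=> le_i; elim: t a => [|x t IHt] a; first by rewrite rmorph1.
move=> /andP [le_ix le_it]; rewrite /= rmorph_sum big_add1 /=.
rewrite big_nat_cond [RHS]big_nat_cond; apply: eq_bigr => b /andP [/andP [le_ab _] _].
have le_abp : (a * p <= b * p)%N by rewrite leq_mul2r le_ab orbT.
rewrite rmorphM /= contract_zvar // IHt; last by apply: sub_all le_it => y; lia.
by rewrite /contract_var !ifF; try lia; congr (z _ * _); lia.
Qed.

(** Along x + b p, the terms before the window from i to i + p - 1 are kept, the single term inside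
    vanishes, and by [contract_chain_ge] the later ones move back by one step of b, closing the
    gap. *)
Lemma contract_chain_lt i x t a : (i <= n * p)%N -> path (spread p) x t ->
    (x + a * p < i + p)%N ->
  contract i (chain_sum p n.+1 (x :: t) a) = chain_sum p n (x :: t) a.
Proof.
move=> le_i; have step u s : all (leq u) s ->
    (forall b, (u + b * p < i)%N ->
      contract i (chain_sum p n.+1 s b) = chain_sum p n s b) ->
  forall b, (u + b * p < i + p)%N ->
    contract i (chain_sum p n.+1 (u :: s) b) = chain_sum p n (u :: s) b.
  move=> le_us IHs b; have [k] := ubnP (i - b); elim: k b => // k IHk b lt_k lt_u.
  have le_b : (b <= b * p)%N by rewrite leq_pmulr.
  rewrite chain_sum_cons; set tail := chain_sum p n.+1 _ _.+1.
  rewrite rmorphD rmorphM /= {}/tail contract_zvar // /contract_var.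
  case: (ltnP (u + b * p) i) => [lt_ui|le_iu]; last first.
    rewrite lt_u mul0r add0r contract_chain_ge //= le_iu /=.
    by apply: sub_all le_us => v; lia.
  by rewrite IHs // [RHS]chain_sum_cons; congr (_ + _); apply: IHk; lia.
elim: t x a => [|y t IHt] x a xt; first by apply: step => // b _; exact: rmorph1.
apply: step => [|b lt_x]; last first.
  (* As y <= x + p, the bound x + b p < i gives y + b p < i + p. *)
  by case/andP: xt => /andP [_ le_yx] yt; apply: IHt => //; lia.
by apply: (order_path_min leq_trans); apply: sub_path xt => u v /andP [].
Qed.

(** The two substitutions differ only at the variables of index i and i + p, by z_i and -z_i
    respectively; divisibility then passes to products and sums. *)
Lemma contract_divides i f : (i < n * p)%N ->
  exists g, contract i.+1 f - contract i f = z i * g.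
Proof.
move=> lt_i; pose P f := exists g, contract i.+1 f - contract i f = z i * g.
have PM f1 f2 : P f1 -> P f2 -> P (f1 * f2).
  move=> [g1 e1] [g2 e2]; exists (g1 * contract i.+1 f2 + contract i f1 * g2).
  rewrite mulrDr mulrA -e1 mulrCA -e2 !rmorphM /=; ring.
have Pz k : P (zvar (n.+1 * p) k).
  rewrite /P !contract_zvar //; last by lia.
  rewrite /contract_var; case: (ltngtP k i) => [lt_k|lt_k|->].
  - by exists 0; rewrite ifT ?subrr ?mulr0 //; lia.
  - rewrite ifF; last by lia.
    case: (ltngtP k (i + p)) => [lt_kp|lt_kp|->].
    + by exists 0; rewrite ifT ?subrr ?mulr0 //; lia.
    + by exists 0; rewrite ifF ?subrr ?mulr0 //; lia.
    by exists (-1); rewrite ifT ?addnK ?sub0r ?mulrN1 //; lia.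
  by exists 1; rewrite ltnSn ifT ?subr0 ?mulr1 //; lia.
elim/mpolyind: f => [|c m f _ _ [g e]]; first by exists 0; rewrite !rmorph0 subrr mulr0.
have [g' e'] : P 'X_[m].
  rewrite -zprod_mseq /zprod; elim/big_rec: _ => [|k f' _ Pf']; last exact: PM.
  by exists 0; rewrite !rmorph1 subrr mulr0.
exists (c *: g' + g); rewrite !rmorphD /= /contract !comp_mpolyZ mulrDr -scalerAr -e -e'.
by rewrite scalerBr opprD addrACA.
Qed.

Definition insert_gap i (j : nat) := if (j < i)%N then j else (j + p)%N.
Definition remove_gap i (j : nat) := if (j < i)%N then j else (j - p)%N.

Lemma insert_gapK i : cancel (insert_gap i) (remove_gap i).
Proof. by move=> j; rewrite /insert_gap /remove_gap; do 2!case: ifP; lia. Qed.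

Lemma remove_gapK i j : ~~ (i <= j < i + p)%N -> insert_gap i (remove_gap i j) = j.
Proof. by rewrite /insert_gap /remove_gap; do 2!case: ifP; lia. Qed.

Definition insert_mon i (m : 'X_{1..n * p}) :=
  mon (n.+1 * p) [seq insert_gap i j | j <- mseq m].

Lemma insert_gap_ltn i s : all (ltn^~ (n * p)%N) s ->
  all (ltn^~ (n.+1 * p)%N) [seq insert_gap i j | j <- s].
Proof.
rewrite all_map; apply: sub_all => j /=; rewrite mulSn /insert_gap; case: ifP; lia.
Qed.

Lemma perm_insert_mon i m :
  perm_eq (mseq (insert_mon i m)) [seq insert_gap i j | j <- mseq m].
Proof. by rewrite perm_mseq_mon // insert_gap_ltn // mseq_ltn. Qed.

Lemma contractX i m : (i <= n * p)%N -> contract i 'X_[m] =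
  if has (fun j => i <= j < i + p)%N (mseq m) then 0
  else 'X_[mon (n * p) [seq remove_gap i j | j <- mseq m]].
Proof.
move=> le_i; rewrite -[in LHS]zprod_mseq /zprod rmorph_prod /=.
rewrite (eq_bigr _ (fun k _ => contract_zvar k le_i)).
case: ifPn => [/hasP [j jm gap_j]|/hasPn ngap].
  rewrite (perm_big _ (perm_to_rem jm)) big_cons /contract_var.
  by case/andP: gap_j => le_ij ->; rewrite ltnNge le_ij /= mul0r.
rewrite -zprod_mon; last first.
  rewrite all_map; apply/allP => j jm /=; have := ngap j jm.
  have := allP (mseq_ltn m) j jm; rewrite /= mulSn /remove_gap; case: ifP; lia.
rewrite /zprod big_map big_seq [RHS]big_seq; apply: eq_bigr => j jm.
rewrite /contract_var /remove_gap; case: ltnP => // le_ij; rewrite ifF //.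
by have := ngap j jm; rewrite le_ij => /negPf.
Qed.

(** R_i kills the monomials meeting the window and is injective on the others, with inverse
    [insert_mon]. *)
Lemma mcoeff_contract i f m : (i <= n * p)%N -> (contract i f)@_m = f@_(insert_mon i m).
Proof.
move=> le_i; elim/mpolyind: f => [|c m' f _ _ IHf]; first by rewrite rmorph0 !mcoeff0.
rewrite rmorphD /= {1}/contract comp_mpolyZ -/(contract i _) !mcoeffD IHf !mcoeffZ.
congr (_ * _ + _); rewrite contractX // mcoeffX; case: ifPn => [gap|ngap].
  rewrite mcoeff0; case: eqP => // m'E; move: gap.
  rewrite m'E (perm_has _ (perm_insert_mon i m)) has_map => /hasP [j _ /=].
  by rewrite /insert_gap; case: ifP; lia.
rewrite mcoeffX; congr (_%:R); congr nat_of_bool; apply/eqP/eqP => [<-|->].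
  rewrite -[LHS]mseqK; apply: eq_mon; rewrite perm_sym.
  apply: perm_trans (perm_map _ (perm_mseq_mon _)) _; last first.
    rewrite -map_comp map_id_in // => j jm /=; apply: remove_gapK.
    exact: (hasPn ngap).
  rewrite all_map; apply/allP => j jm /=; have := hasPn ngap j jm.
  have := allP (mseq_ltn m') j jm; rewrite /= mulSn /remove_gap; case: ifP; lia.
rewrite -[RHS]mseqK; apply: eq_mon.
apply: perm_trans (perm_map _ (perm_insert_mon i m)) _.
by rewrite -map_comp map_id_in // => j _ /=; apply: insert_gapK.
Qed.

(** Beyond i, inserting the gap moves the threshold one step up, which allows one more entry; k
    takes that place. *)
Lemma good_contract i k s : (k <= i + p)%N ->
  good p (k :: [seq insert_gap i j | j <- s]) -> good p s.
Proof.
move=> le_k gs r; case: (leqP (r.+1 * p) i) => [le_ri|lt_ir].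
  apply: leq_trans (gs r); rewrite /= count_map; apply: leq_trans (leq_addl _ _).
  by apply: sub_count => x /=; rewrite /insert_gap => lt_x; rewrite ifT //; lia.
rewrite -ltnS -add1n; apply: leq_trans (gs r.+1); rewrite /= (mulSn r.+1).
rewrite (_ : (k < _)%N = true) ?leq_add2l ?count_map; last by lia.
by apply: sub_count => x /=; rewrite /insert_gap; case: ifP; lia.
Qed.

End Contraction.

(** * Ideal elements supported on good monomials vanish *)

Section LowerBound.

Variables (p : nat) (p_gt0 : (0 < p)%N).

Lemma contract_fundamental n i c : (i <= n * p)%N -> pcomposition p c ->
  contract i (fundamental n.+1 p_gt0 c) = fundamental n p_gt0 c.
Proof.
move=> le_i pc; rewrite !fundamentalE //.
have /andP [_ /runs_spread [sp lt_p]] := pc.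
case: (posnP (sumn c)) => [c0|c_gt0]; first by rewrite /runs c0; exact: rmorph1.
have {lt_p} := lt_p c_gt0; move: sp; rewrite /runs -(prednK c_gt0) => sp lt_p.
by apply: contract_chain_lt => //; rewrite mul0n addn0; apply: ltn_addl.
Qed.

Lemma mon_nil N : mon N [::] = 0%MM.
Proof. by apply/mnmP => k; rewrite !mnmE. Qed.

Lemma mseq0 N : mseq (0%MM : 'X_{1..N}) = [::].
Proof. by apply: size0nil; rewrite size_mseq mdeg0. Qed.

Lemma contract_quasisymmetric n i q : (i <= n * p)%N ->
    Gquasisymmetric0 p_gt0 (n := n.+1) q ->
  Gquasisymmetric0 p_gt0 (contract i q) /\ contract i q = contract 0 q.
Proof.
move=> le_i [[s s_fund ->] q0]; split; last first.
  rewrite !rmorph_sum /=; apply: eq_big_seq => x /s_fund [c pc xc].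
  by rewrite !linearZ xc /= !contract_fundamental.
split; last by rewrite mcoeff_contract // /insert_mon mseq0 mon_nil.
exists [seq (x.1, contract i x.2) | x <- s].
  move=> _ /mapP [x /s_fund [c pc xc] ->]; exists c => //=.
  by rewrite xc contract_fundamental.
by rewrite rmorph_sum big_map; apply: eq_bigr => x _; rewrite /= linearZ.
Qed.

Lemma ideal_const0 n f : f \in ideal_gen (Gquasisymmetric0 p_gt0 (n := n)) -> f@_0%MM = 0.
Proof.
move=> /asboolP [s Ss ->]; rewrite raddf_sum big_seq big1 //= => x /Ss [_ x0].
by rewrite rmorphM /= x0 mulr0.
Qed.

(** Both substitutions agree on a generator q, so on a product a q their difference is the
    difference on a, divisible by z_i, times the image of q. *)
Lemma contract_ideal n i f : (i < n * p)%N ->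
    f \in ideal_gen (Gquasisymmetric0 p_gt0 (n := n.+1)) ->
  exists2 g, g \in ideal_gen (Gquasisymmetric0 p_gt0 (n := n)) &
    contract i.+1 f - contract i f = zvar (n * p) i * g.
Proof.
move=> lt_i /asboolP [s Ss ->]; rewrite !rmorph_sum -sumrB big_seq.
elim/big_rec: _ => [|[a q] f' /Ss /= Sq [g gI ->]].
  by exists 0; rewrite ?rpred0 ?mulr0.
have [b ab] := contract_divides p_gt0 a lt_i.
have [Sq1 eq1] := contract_quasisymmetric lt_i Sq.
have [_ eq0] := contract_quasisymmetric (ltnW lt_i) Sq.
exists (b * contract i.+1 q + g).
  by apply: rpredD gI; apply: ideal_genMl; apply: mem_ideal_gen.
by rewrite !rmorphM /= [contract i q]eq0 -eq1 -mulrBl ab mulrDr mulrA.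
Qed.

Lemma perm_mseqDU N (m : 'X_{1..N}) (i : 'I_N) :
  perm_eq (mseq (m + U_(i))%MM) ((i : nat) :: mseq m).
Proof.
rewrite (_ : (m + U_(i))%MM = mon N ((i : nat) :: mseq m)).
  by apply: perm_mseq_mon; rewrite /= ltn_ord mseq_ltn.
by apply/mnmP => j; rewrite mnmDE mnm1E mnmE /= count_mem_mseq addnC.
Qed.

Lemma good_gap s : good p s -> all (leq p) s.
Proof.
move=> /(_ 0%N); rewrite mul1n leqn0 -[_ == _]negbK -lt0n -has_count -all_predC.
by apply: sub_all => x /=; rewrite -leqNgt.
Qed.

Lemma good_ideal0 n f : f \in ideal_gen (Gquasisymmetric0 p_gt0 (n := n)) ->
  supp_in (@good_monomial p _) f -> f = 0.
Proof.
elim: n f => [|n IHn] f fI gf; apply/mpolyP => m; rewrite mcoeff0.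
  by rewrite -(ideal_const0 fI); congr (_@__); apply/mnmP => -[].
(* The coefficient of f does not depend on where the gap is inserted; this uses the induction
   hypothesis on n. *)
have gapP i m' : (i <= n * p)%N -> f@_(insert_mon i m') = f@_(insert_mon 0 m').
  elim: i => // i IHi lt_i; rewrite -IHi 1?ltnW // -!mcoeff_contract // 1?ltnW //.
  have [g gI eg] := contract_ideal lt_i fI.
  suff g0 : g = 0 by apply/eqP; rewrite -subr_eq0 -mcoeffB eg g0 mulr0 mcoeff0.
  apply: IHn gI _ => m1; rewrite mcoeff_msupp => gm1.
  have : (zvar (n * p) i * g)@_(m1 + U_(Ordinal lt_i)) != 0.
    by rewrite (zvar_ord (Ordinal lt_i)) mulrC addmC mcoeffMX.
  have gap_good i' : (i <= i' <= i.+1)%N -> f@_(insert_mon i' (m1 + U_(Ordinal lt_i))) != 0 ->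
      good_monomial p m1.
    move=> le_i'; rewrite -mcoeff_msupp => /gf; rewrite /good_monomial.
    move/(good_perm (perm_insert_mon p_gt0 _ _)).
    move/(good_perm (perm_map _ (perm_mseqDU _ _))) => /=.
    by apply: good_contract => //; rewrite /insert_gap; case: ifP; lia.
  rewrite -eg mcoeffB !mcoeff_contract //; last exact: ltnW.
  have [->|nz _] := eqVneq (f@_(insert_mon i.+1 (m1 + U_(Ordinal lt_i))%MM)) 0; last first.
    by apply: (gap_good i.+1); rewrite ?leqnSn ?leqnn.
  by rewrite sub0r oppr_eq0; apply: (gap_good i); rewrite leqnn leqnSn.
apply/eqP; rewrite mcoeff_eq0; apply/negP => mf.
have m_neq0 : mseq m != [::].
  apply/eqP => m0; move: mf; rewrite mcoeff_msupp -[m]mseqK m0 mon_nil.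
  by rewrite ideal_const0 ?eqxx.
(* Descent on the sum of the indices: m is its downward shift s with a gap inserted at 0. Moving the
   gap to n p, beyond all of s, puts s itself in the support of f. *)
have [k] := ubnP (sumn (mseq m)); elim: k m mf m_neq0 => // k IHk m mf m_neq0 lt_k.
have gm := good_gap (gf m mf); pose s := [seq (x - p)%N | x <- mseq m].
have lt_s : all (ltn^~ (n * p)%N) s.
  rewrite all_map; apply/allP => x xm /=.
  by have := allP gm x xm; have := allP (mseq_ltn m) x xm; rewrite /= mulSn; lia.
have lt_s1 : all (ltn^~ (n.+1 * p)%N) s.
  by apply: sub_all lt_s => x /=; rewrite mulSn; lia.
have perm_s : perm_eq (mseq (mon (n.+1 * p) s)) s by apply: perm_mseq_mon.
apply: (IHk (mon (n.+1 * p) s)).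
- rewrite mcoeff_msupp; rewrite mcoeff_msupp in mf.
  have <- : insert_mon (n * p) (mon (n * p) s) = mon (n.+1 * p) s.
    apply: eq_mon; apply: perm_trans (perm_map _ (perm_mseq_mon lt_s)) _.
    rewrite map_id_in // => x /(allP lt_s) /= ltx.
    by rewrite /insert_gap ltx.
  rewrite gapP //; have -> // : insert_mon 0 (mon (n * p) s) = m.
  rewrite -[RHS]mseqK; apply: eq_mon.
  apply: perm_trans (perm_map _ (perm_mseq_mon lt_s)) _.
  rewrite -map_comp map_id_in // => x /(allP gm) le_px.
  by rewrite /insert_gap /= subnK.
- by rewrite -size_eq0 (perm_size perm_s) size_map size_eq0.
rewrite (perm_sumn perm_s); rewrite ltnS in lt_k; apply: leq_trans lt_k; rewrite /s.
case: (mseq m) m_neq0 gm => // x t _ /= /andP [le_px _].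
rewrite -addSn; apply: leq_add; first by lia.
by elim: t => //= y t IHt; apply: leq_add => //; apply: leq_subr.
Qed.

End LowerBound.

(** * Enumeration of good monomials *)

Section Enumeration.

Variables (p : nat) (p_gt0 : (0 < p)%N).

Fixpoint good_seqs (d u : nat) : seq (seq nat) :=
  if d is d'.+1 then
    [seq rcons s v | v <- [seq v <- iota 0 u | (d * p <= v)%N], s <- good_seqs d' v.+1]
  else [:: [::]].

(** The largest entry v only counts at thresholds above v, where all of s is counted as well. *)
Lemma good_rcons s v : all (geq v) s ->
  good p (rcons s v) <-> good p s /\ ((size s).+1 * p <= v)%N.
Proof.
move=> le_sv; split=> [gsv|[gs le_v] r]; last first.
  rewrite -cats1 count_cat /= addn0; case: ltnP => [lt_v|_]; last by rewrite addn0.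
  have lt_sr : (size s < r)%N.
    by rewrite -ltnS -(ltn_pmul2r (m := p)); lia.
  by rewrite addn1; apply: leq_trans lt_sr; apply: count_size.
split=> [r|]; first by apply: leq_trans (gsv r); rewrite -cats1 count_cat leq_addr.
rewrite leqNgt; apply/negP => lt_v; have := gsv (size s).
rewrite -cats1 count_cat /= lt_v leqNgt addn1 ltnS -count_predT => /negP; apply.
apply: eq_leq; apply: eq_in_count => x /(allP le_sv) /= le_xv.
by rewrite (leq_ltn_trans le_xv).
Qed.

Lemma good_seqsP d u s : reflect
  [/\ size s = d, all (ltn^~ u) s, pairwise leq s & good p s] (s \in good_seqs d u).
Proof.
elim: d u s => [|d IHd] u s.
  by rewrite inE; apply: (iffP eqP) => [->|[/size0nil]].
apply: (iffP allpairsPdep) => [[v [s' []]]|].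
  rewrite mem_filter mem_iota => /andP [le_v /= lt_v] /IHd [sz lt_s' sP gs] ->.
  rewrite size_rcons sz all_rcons lt_v /=; split=> //.
  - by apply: sub_all lt_s' => x /=; lia.
  - by rewrite -cats1 pairwise_cat allrel1r sP andbT.
  by apply/good_rcons; [exact: lt_s' | rewrite sz].
case: (lastP s) => [[]//|{}s v].
rewrite size_rcons all_rcons -cats1 pairwise_cat allrel1r cats1.
move=> [[sz] /andP [/= lt_v lt_s] /and3P [le_sv sP _] /(good_rcons le_sv) [gs le_v]].
exists v, s; rewrite mem_filter mem_iota; split=> //; first by rewrite -sz le_v lt_v.
by apply/IHd.
Qed.

Lemma uniq_good_seqs d u : uniq (good_seqs d u).
Proof.
elim: d u => //= d IHd u; apply: allpairs_uniq_dep => [|v _|].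
- by rewrite filter_uniq ?iota_uniq.
- exact: IHd.
by move=> [v s] [v' s'] _ _ /= /rcons_inj [-> ->].
Qed.

Lemma size_good_seqsS d u : size (good_seqs d.+1 u.+1) =
  (size (good_seqs d.+1 u) + (if (d.+1 * p <= u)%N then size (good_seqs d u.+1) else 0))%N.
Proof.
have gsE v : good_seqs d.+1 v = [seq rcons s w |
    w <- [seq w <- iota 0 v | (d.+1 * p <= w)%N], s <- good_seqs d w.+1] by [].
rewrite !gsE -[X in iota 0 X](addn1 u) iotaD filter_cat /= add0n.
case: ifP => _; last by rewrite cats0 addn0.
by rewrite allpairs_cat size_cat /= cats0 size_map.
Qed.

(** The ballot number (u - d p) / (u + d) times the binomial of u + d over d, with denominators
    cleared; by induction on d, then on u - d p. *)
Lemma size_good_seqs d u : (0 < u)%N -> (d * p <= u)%N ->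
  (size (good_seqs d u) * (u + d) = (u - d * p) * 'C(u + d, d))%N.
Proof.
elim: d u => [|d IHd] u u_gt0 le_u; first by rewrite mul1n mul0n subn0 addn0 bin0 muln1.
have [w] : exists w, u = (d.+1 * p + w)%N by exists (u - d.+1 * p)%N; lia.
elim: w u u_gt0 le_u => [|w IHw] u u_gt0 le_u uE.
  (* For u = (d + 1) p no last entry is possible. *)
  rewrite uE addn0 subnn mul0n /= (@eq_in_filter _ _ pred0) ?filter_pred0 // => v.
  by rewrite mem_iota add0n => /andP [_ lt_v]; apply/negbTE; rewrite -ltnNge.
pose v := (d.+1 * p + w)%N; have {uE} -> : u = v.+1 by rewrite uE /v addnS.
have v_gt0 : (0 < v)%N by rewrite /v mulSn -addnA ltn_addr.
have le_v : (d.+1 * p <= v)%N by apply: leq_addr.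
have := IHw v v_gt0 le_v erefl; have := IHd v.+1 isT.
have /[swap]/[apply] : (d * p <= v.+1)%N by rewrite mulSn in le_v; lia.
rewrite size_good_seqsS le_v addSnnS binS (_ : v - _ = w)%N; last by rewrite /v addKn.
rewrite (_ : v.+1 - d * p = w + p.+1)%N; last by rewrite /v mulSn; lia.
rewrite (_ : v.+1 - d.+1 * p = w.+1)%N; last by rewrite /v; lia.
have := mul_bin_left (v + d.+1) d; rewrite (_ : v + d.+1 - d = v.+1)%N; last by lia.
move: (size _) (size _) 'C(_, _) 'C(_, _) => f2 f1 A B.
(* After these scalings the goal is a linear combination of [e1], [e2] and [eAB]. *)
move=> eAB e1 e2; apply/eqP; rewrite -(eqn_pmul2l (m := v + d.+1)) ?addnS //; apply/eqP.
have {}e1 : (f1 * (v + d.+1) * (v.+1 + d.+1) = (w + p.+1) * A * (v.+1 + d.+1))%N by rewrite e1.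
have {}e2 : (f2 * (v + d.+1) * (v.+1 + d.+1) = w * B * (v.+1 + d.+1))%N by rewrite e2.
have {}eAB : (d.+1 * B * p.+1 = v.+1 * A * p.+1)%N by rewrite eAB.
rewrite /v in e1 e2 eAB *; lia.
Qed.

(** Lengths up to n suffice: for n > 0, a good sequence has at most n - 1 entries below n p. *)
Definition basis_seqs n := [seq s | d <- iota 0 n.+1, s <- good_seqs d (n * p)].

Lemma mem_basis_seqs n s : reflect
  [/\ all (ltn^~ (n * p)%N) s, pairwise leq s & good p s] (s \in basis_seqs n).
Proof.
apply: (iffP allpairsPdep) => [[d [s' [_ /good_seqsP [_ ? ? ?] ->]]]|[lt_s sP gs]] //.
exists (size s), s; rewrite mem_iota /=; split=> //; last exact/good_seqsP.
case: n lt_s => [|n] lt_s; first by case: s lt_s {sP gs}.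
by have := gs n; move: lt_s; rewrite all_count => /eqP ->; lia.
Qed.

Lemma uniq_basis_seqs n : uniq (basis_seqs n).
Proof.
apply: allpairs_uniq_dep => [|d _|]; [exact: iota_uniq | exact: uniq_good_seqs |].
have tagE x : x \in [seq existT (fun=> seq nat) d s | d <- iota 0 n.+1,
    s <- good_seqs d (n * p)] -> x = existT _ (size (tagged x)) (tagged x).
  by case/allpairsPdep => d [s [_ /good_seqsP [sz _ _ _] ->]]; rewrite /= sz.
by move=> x y /tagE -> /tagE -> /= ->.
Qed.

(** The recursion telescopes; bijectively, a sequence of length d is padded with n - d entries equal
    to n p. *)
Lemma size_basis_seqs n : size (basis_seqs n) = size (good_seqs n (n * p).+1).
Proof.
suff aux k : (k <= n)%N -> size [seq s | d <- iota 0 k.+1, s <- good_seqs d (n * p)] =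
    size (good_seqs k (n * p).+1) by apply: aux.
elim: k => // k IHk lt_k; rewrite size_good_seqsS leq_mul2r lt_k orbT -IHk 1?ltnW //.
by rewrite -[X in iota 0 X](addn1 k.+1) iotaD allpairs_cat size_cat addnC /= cats0 map_id.
Qed.

Lemma fuss_catalan n : (0 < n)%N ->
  (size (basis_seqs n))%:R = 1 / (p * n + 1)%:R * 'C((p + 1) * n, n)%:R :> rat.
Proof.
move=> n_gt0; rewrite size_basis_seqs.
(* Here u = n p + 1, so the factor u - d p is 1. *)
have := @size_good_seqs n (n * p).+1 isT (leqnSn _).
rewrite subSnn mul1n => e; have := mul_bin_down ((n * p).+1 + n) n.
rewrite addSn subSn ?leq_addl // addnK /= => e'.
have {}e : (size (good_seqs n (n * p).+1) * (n * p).+1 = 'C(n * p + n, n))%N.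
  apply/eqP; rewrite -(eqn_pmul2l (m := (n * p + n).+1)) //; apply/eqP.
  by rewrite addSn in e; rewrite e' -e; lia.
rewrite (_ : (p + 1) * n = n * p + n)%N; last by lia.
rewrite -e natrM mul1r mulrCA (_ : p * n + 1 = (n * p).+1)%N; last by lia.
by rewrite mulVf ?mulr1 // Num.Theory.pnatr_eq0.
Qed.

End Enumeration.

(** * Dimension of a quotient from a monomial basis *)

Section Dimension.

Variables (N : nat) (S : {mpoly rat[N]} -> Prop) (B : seq 'X_{1..N}).
Hypothesis uniqB : uniq B.
Hypothesis spanB : forall f, exists2 g, supp_in (fun m => m \in B) g & f - g \in ideal_gen S.
Hypothesis freeB : forall f, f \in ideal_gen S -> supp_in (fun m => m \in B) f -> f = 0.

Local Open Scope quotient_scope.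

Let Q : lmodType rat := ideal_quotient S.

Definition combination (r : 'rV[rat]_(size B)) : {mpoly rat[N]} :=
  \sum_i r 0 i *: 'X_[tnth (in_tuple B) i].

Lemma mcoeff_combination r i : (combination r)@_(tnth (in_tuple B) i) = r 0 i.
Proof.
rewrite raddf_sum (bigD1 i) //= mcoeffZ mcoeffX eqxx mulr1 big1 ?addr0 // => j nij.
by rewrite mcoeffZ mcoeffX (inj_eq (elimT (tuple_uniqP (in_tuple B)) uniqB)) (negPf nij) mulr0.
Qed.

Lemma supp_combination r : supp_in (fun m => m \in B) (combination r).
Proof.
apply: supp_in_sum => i _; apply: supp_inZ; apply: supp_inX.
exact: (mem_tnth i (in_tuple B)).
Qed.

Lemma combination_linear : linear combination.
Proof.
move=> a r s; rewrite scaler_sumr -big_split; apply: eq_bigr => i _ /=.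
by rewrite !mxE scalerDl scalerA.
Qed.

Lemma combinationP g : supp_in (fun m => m \in B) g -> exists r, combination r = g.
Proof.
move=> gB; exists (\row_i g@_(tnth (in_tuple B) i)); apply/mpolyP => m.
case: (boolP (m \in B)) => [/(tnthP (in_tuple B)) [i ->]|mB].
  by rewrite mcoeff_combination mxE.
rewrite !memN_msupp_eq0 //; first by apply: contra mB => /gB.
by apply: contra mB => /supp_combination.
Qed.

Lemma quotient_dim : has_dim Q (size B).
Proof.
pose phi r : Q := \pi_(ideal_quotient S) (combination r).
have phi_lin : linear phi.
  move=> a r s; rewrite /phi combination_linear raddfD; congr (_ + _).
  by symmetry; apply: quotient_scaleE.
have phi_inj : injective phi.
  move=> r s /eqP; rewrite -Quotient.idealrBE => rsI; apply/rowP => i.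
  rewrite -!mcoeff_combination; congr (_@__); apply/eqP; rewrite -subr_eq0.
  by apply/eqP/freeB => //; apply: supp_inB; apply: supp_combination.
have phi_surj v : exists r, phi r = v.
  elim/quotW: v => f; have [g gB fgI] := spanB f; have [r rg] := combinationP gB.
  by exists r; apply/eqP; rewrite eq_sym -Quotient.idealrBE rg.
(* The coordinate map is the inverse of the bijection [phi], obtained by choice. *)
pose psi v := sval (cid (phi_surj v)).
have psiK v : phi (psi v) = v by rewrite /psi; case: cid.
constructor; exists psi; last by exists phi => // r; apply: phi_inj; rewrite psiK.
by move=> a u v; apply: phi_inj; rewrite phi_lin !psiK.
Qed.

End Dimension.

(** By [spread_runs] this is a fundamental polynomial; being homogeneous of positive degree, it has
    no constant term. *)
Lemma chain_sum_ideal p n (p_gt0 : (0 < p)%N) x t : (x < p)%N -> path (spread p) x t ->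
  chain_sum p n (x :: t) 0 \in ideal_gen (Gquasisymmetric0 (n := n) p_gt0).
Proof.
move=> lt_xp xt; have [c pc cE] := spread_runs p_gt0 lt_xp xt.
apply: mem_ideal_gen; split.
  exists [:: (1, chain_sum p n (x :: t) 0)]; last by rewrite big_seq1 scale1r.
  by move=> y; rewrite inE => /eqP -> /=; exists c; rewrite ?fundamentalE ?cE.
apply: memN_msupp_eq0; apply/negP => /supp_chain_sum [].
by rewrite mdeg0.
Qed.

Lemma basis_monomialP p (p_gt0 : (0 < p)%N) n (m : 'X_{1..n * p}) :
  m \in [seq mon (n * p) s | s <- basis_seqs p n] <-> good_monomial p m.
Proof.
split=> [/mapP [s /(mem_basis_seqs p_gt0) [lt_s _ gs] ->]|gm].
  by apply: good_perm gs; rewrite perm_sym perm_mseq_mon.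
apply/mapP; exists (mseq m); last by rewrite mseqK.
apply/(mem_basis_seqs p_gt0); split; [exact: mseq_ltn | | exact: gm].
by rewrite -(sorted_pairwise leq_trans); apply: sort_sorted leq_total _.
Qed.

Lemma uniq_basis_monomials p (p_gt0 : (0 < p)%N) n :
  uniq [seq mon (n * p) s | s <- basis_seqs p n].
Proof.
rewrite map_inj_in_uniq ?uniq_basis_seqs //.
move=> s t /(mem_basis_seqs p_gt0) [lt_s sP _] /(mem_basis_seqs p_gt0) [lt_t tP _] mon_st.
apply: (sorted_eq leq_trans anti_leq); rewrite ?(sorted_pairwise leq_trans) //.
by rewrite -(permPl (perm_mseq_mon lt_s)) mon_st perm_mseq_mon.
Qed.

Theorem theorem3 (p n : nat) (p_gt0 : (0 < p)%N) (n_gt0 : (0 < n)%N) :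
  exists2 d : nat,
    has_dim (Gquotient n p_gt0) d
    & d%:R = 1 / (p * n + 1)%:R * 'C((p + 1) * n, n)%:R :> rat.
Proof.
exists (size (basis_seqs p n)); last exact: fuss_catalan.
rewrite -(size_map (mon (n * p))); apply: quotient_dim.
- exact: uniq_basis_monomials.
- move=> f; have [g gg fgI] := good_span p_gt0 (@chain_sum_ideal p n p_gt0) f.
  by exists g => //; apply: supp_inW gg => m /(basis_monomialP p_gt0).
move=> f fI fB; apply: good_ideal0 fI _.
by apply: supp_inW fB => m /(basis_monomialP p_gt0).
Qed.
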